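(* $$\int_0^{\pi/2} e^{-\sec^2(x)}\,dx = \frac{\pi}{2}\,\mathrm{erfc}(1).$$
   Context: The complementary error function is $\mathrm{erfc}(x)=\frac{2}{\sqrt{\pi}}\int_x^{\infty} e^{-t^2}\,dt$. *)

(* Defs.v *)
From mathcomp Require Import all_boot all_order all_algebra.
From mathcomp Require Import all_classical all_reals all_analysis.

Set Implicit Arguments.
Unset Strict Implicit.
Unset Printing Implicit Defensive.

Import Order.TTheory GRing.Theory Num.Theory.
Import numFieldNormedType.Exports.

Local Open Scope classical_set_scope.
Local Open Scope ring_scope.

(* [0^-1 = 0], so [sec] takes the value 0 where [cos] vanishes. *)
Definition sec {R : realType} (x : R) : R := (cos x)^-1.

Definition erfc {R : realType} (x : R) : R :=
  2 / Num.sqrt pi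
  * (\int[@lebesgue_measure R]_(t in `[x, +oo[) expR (- t ^+ 2)).

(* Main.v *)
Require Import Defs.
From mathcomp Require Import all_boot all_order all_algebra.
From mathcomp Require Import all_classical all_reals all_analysis.
From mathcomp Require Import measurable_realfun ring.

Import Order.TTheory GRing.Theory Num.Theory.
Import numFieldNormedType.Exports.

Local Open Scope classical_set_scope.
Local Open Scope ring_scope.

(** Substituting t = tan x turns the integral into that of
    exp(-(1 + t^2)) / (1 + t^2) over [0, +oo[, and this integrand is itself
    the integral over y >= 1 of 2 y exp(-y^2 (1 + t^2)).  By Tonelli the
    integral over t comes first: it is Gaussian, equal to sqrt(pi) / (2 y), and
    what remains is sqrt(pi) times the integral of exp(-y^2) over [1, +oo[. *)

Lemma sec_sqr_atan (R : realType) (t : R) : sec (atan t) ^+ 2 = oneDsqr t.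
Proof. by rewrite /sec cos_atan invrK sqr_sqrtr// addr_ge0// sqr_ge0. Qed.

Lemma continuous_expR_Nsec_sqr (R : realType) (x : R) :
  cos x != 0 -> {for x, continuous (fun x => expR (- sec x ^+ 2))}.
Proof.
move=> cosx; apply: (@continuous_comp _ _ _ (fun x => - sec x ^+ 2) expR).
  apply: cvgN; apply: (cvg_comp sec (fun z => z ^+ 2)); last first.
    exact: exprn_continuous.
  by apply: cvgV => //; exact: continuous_cos.
exact: continuous_expR.
Qed.

(** The integrand lies between 0 and 1 on an interval of finite length, so only measurability has to
    be argued. *)
Lemma integrable_expR_Nsec_sqr (R : realType) :
  (@lebesgue_measure R).-integrable `[0, pi / 2]
    (EFin \o (fun x => expR (- sec x ^+ 2))).
Proof.
apply: measurable_bounded_integrable => //=.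
- by rewrite lebesgue_measure_itv/=; case: ifPn => // _; rewrite -EFinB ltry.
(* Dropping the endpoints does not affect measurability. At [pi / 2] continuity fails: [sec] is 0
   there by convention, so the integrand takes the value 1 while its left limit is 0. *)
- apply/measurable_fun_itv_bndo_bndcP/measurable_fun_itv_obnd_cbndP.
  apply: open_continuous_measurable_fun; first exact: interval_open.
  move=> x /[!inE] /=; rewrite in_itv/= => /andP[x0 xpi2].
  apply: continuous_expR_Nsec_sqr; rewrite gt_eqF// cos_gt0_pihalf// xpi2 andbT.
  by rewrite (lt_trans _ x0)// oppr_lt0 divr_gt0// pi_gt0.
- exists 1; split => // M M1 x _ /=.
  rewrite ger0_norm ?expR_ge0// (le_trans _ (ltW M1))//.
  by rewrite -expR0 ler_expR oppr_le0 sqr_ge0.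
Qed.

Lemma integral_expR_Nsec_sqr (R : realType) :
  (\int[@lebesgue_measure R]_(x in `[0%R, (pi / 2)%R])
      (expR (- sec x ^+ 2))%:E =
   \int[@lebesgue_measure R]_(t in `[0%R, +oo[)
      (expR (- oneDsqr t) / oneDsqr t)%:E)%E.
Proof.
pose g (x : R) := expR (- sec x ^+ 2).
(* The substitution is the FTC on [0, +oo[ for [P \o atan]; this way no
   substitution rule with a finite limit at infinity is needed. *)
pose P (x : R) := parameterized_integral (@lebesgue_measure R) 0 x g.
have ig := @integrable_expR_Nsec_sqr R.
have pi2 : 0 < pi / 2 :> R by rewrite divr_gt0// pi_gt0.
(* A primitive of an integrable function is continuous up to both endpoints, so the jump of [g] at
   [pi / 2] is harmless. *)
have /(continuous_within_itvP _ pi2)[_ P0 Ppi2] :=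
  parameterized_integral_continuous (ltW pi2) ig.
have P00 : P 0 = 0.
  by rewrite /P /parameterized_integral set_itv1 Rintegral_set1.
have atan_gt0 t : 0 < t -> 0 < atan t :> R.
  by rewrite -[X in _ -> X < _]atan0; exact: lt_atan.
(* For [t > 0], [atan t] is interior to [[0, pi / 2]], where [g] is continuous. The chain rule then
   gives [g (atan t)], which is [expR (- oneDsqr t)], times the derivative [1 / oneDsqr t] of
   [atan]. *)
have dP t : 0 < t ->
    is_derive (t : R) 1 (P \o atan) (expR (- oneDsqr t) / oneDsqr t).
  move=> t0.
  have [||] := continuous_FTC1 (atan_ltpi2 t) ig.
  - by rewrite /= lte_fin atan_gt0.
  - apply: continuous_expR_Nsec_sqr; rewrite gt_eqF// cos_gt0_pihalf//.
    by rewrite atan_gtNpi2 atan_ltpi2.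
  rewrite sec_sqr_atan => dPt Pt.
  have dP : is_derive (atan t) 1 P (expR (- oneDsqr t)).
    by split; [exact: dPt|rewrite -derive1E].
  exact: is_derive1_comp.
rewrite (@ge0_continuous_FTC2y _ _ (P \o atan) _ (P (pi / 2))).
- rewrite /= atan0 P00 sube0 /P /parameterized_integral /Rintegral fineK//.
  exact: integrable_fin_num.
- by move=> t _; rewrite divr_ge0 ?expR_ge0// (le_trans ler01)// oneDsqr_ge1.
- apply: continuous_subspaceT => t; apply: cvgM.
    apply: (cvg_comp _ expR); last exact: continuous_expR.
    by apply: cvgN; exact: continuous_oneDsqr.
  exact: continuous_oneDsqrV.
(* [P] is only known to be left-continuous at [pi / 2]; this suffices because [atan] stays strictly
   below its limit. *)
- have atan_left : atan t @[t --> +oo] --> (pi / 2 : R)^'-.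
    move=> A /cvgy_atan nA; change (\forall t \near +oo, A (atan (t : R))).
    by near=> t; have := atan_ltpi2 t; near: t; exact: nA.
  exact: (cvg_comp _ _ atan_left Ppi2).
- by move=> t /dP[].
- rewrite [(P \o atan) 0]/= atan0.
  have atan0r : atan t @[t --> 0^'+] --> (0:R)^'+.
    have catan : atan t @[t --> (0:R)] --> (0:R).
      by have := @continuous_atan R 0; rewrite /prop_for /continuous_at atan0.
    move=> A /catan nA; change (\forall t \near 0^'+, A (atan (t : R))).
    near=> t; have : 0 < atan t by exact: atan_gt0.
    by near: t; apply: cvg_within; exact: nA.
  exact: (cvg_comp _ _ atan0r P0).
- by move=> t; rewrite in_itv/= andbT => /dP dPt; rewrite derive1E; exact: derive_val.
Unshelve. all: end_near. Qed.

(** The factor [2 * y] makes the integrand an exact derivative, with a primitive that vanishes at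
    infinity. It is used with [a = oneDsqr t]. *)
Lemma integral_expR_sqrM (R : realType) (a : R) : 0 < a ->
  (\int[@lebesgue_measure R]_(y in `[1%R, +oo[)
      (2 * y * expR (- (y ^+ 2 * a)))%:E = (expR (- a) / a)%:E)%E.
Proof.
move=> a0.
rewrite (@ge0_continuous_FTC2y _ _ (fun y => - (expR (- (y ^+ 2 * a)) / a)) _ 0).
- by rewrite -EFinB expr1n mul1r opprK add0r.
- by move=> y y1; rewrite mulr_ge0 ?expR_ge0// mulr_ge0// (le_trans _ y1).
- apply: continuous_subspaceT => y; apply: cvgM.
    by apply: cvgM; [exact: cvg_cst|exact: cvg_id].
  apply: (cvg_comp _ expR); last exact: continuous_expR.
  apply: cvgN; apply: cvgM; last exact: cvg_cst.
  exact: exprn_continuous.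
- rewrite -[X in _ --> X]oppr0 -[X in - X](mul0r a^-1).
  apply: cvgN; apply: cvgM; last exact: cvg_cst.
  apply: (cvg_comp (fun y => y ^+ 2 * a) (fun y => expR (- y))); last first.
    exact: cvgr_expR.
  by apply: gt0_cvgMly => //; exact: cvgr_expr2.
- by move=> y _; exact: ex_derive.
- apply: cvg_at_right_filter.
  apply: cvgN; apply: cvgM; last exact: cvg_cst.
  apply: (cvg_comp _ expR); last exact: continuous_expR.
  apply: cvgN; apply: cvgM; last exact: cvg_cst.
  exact: exprn_continuous.
- move=> y _; rewrite derive1E derive_val /GRing.scale/=; field.
  exact: lt0r_neq0.
Qed.

Lemma integral0y_gauss_scale (R : realType) (y : R) : 0 < y ->
  (\int[@lebesgue_measure R]_(t in `[0%R, +oo[)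
      (y * gauss_fun (y * t))%:E = (Num.sqrt pi / 2)%:E)%E.
Proof.
move=> y0; rewrite -integral0y_gauss.
have dy : (fun t => y * t)^`()%classic = cst y.
  by apply/funext => t; rewrite derive1Ml// derive1_id mulr1.
(* The lower bound 0 is presented as the image of 0 under [t |-> y * t], the form the substitution
   rule expects. *)
rewrite -[in RHS](mulr0 y).
rewrite (@increasing_ge0_integration_by_substitutiony _ (fun t => y * t) gauss_fun).
- by apply: eq_integral => t _; rewrite dy mulrC.
- by move=> s t _ _ st; rewrite ltr_pM2l.
- by rewrite dy => t _; exact: cvg_cst.
- by rewrite dy; exact: is_cvg_cst.
- by rewrite dy; exact: is_cvg_cst.
- split; first by move=> t _; exact: ex_derive.
  by apply: cvg_at_right_filter; apply: cvgM; [exact: cvg_cst|exact: cvg_id].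
- by apply: gt0_cvgMry => //; exact: cvg_id.
- by apply: continuous_subspaceT; exact: continuous_gauss_fun.
- by move=> t _; exact: gauss_fun_ge0.
Qed.

Lemma ge0_exchange_integral (R : realType) (A B : set R) (f : R * R -> R) :
  measurable A -> measurable B -> measurable_fun setT f ->
  (forall x y, A x -> B y -> 0 <= f (x, y)) ->
  (\int[@lebesgue_measure R]_(x in A) \int[@lebesgue_measure R]_(y in B)
     (f (x, y))%:E =
   \int[@lebesgue_measure R]_(y in B) \int[@lebesgue_measure R]_(x in A)
     (f (x, y))%:E)%E.
Proof.
move=> mA mB mf f0.
(* Sign information on [f] is available only on the product of [A] and [B]; extension by zero gives
   a function that is nonnegative everywhere, to which Tonelli on the whole plane applies. *)
pose h := (EFin \o f) \_ (A `*` B).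
have hE x y : h (x, y) = ((fun x => (fun y => (f (x, y))%:E) \_ B y) \_ A) x.
  rewrite /h !patchE.
  have [xA|xA] := boolP (x \in A); have [yB|yB] := boolP (y \in B).
  - by rewrite mem_set//; split; exact/set_mem.
  - by rewrite memNset// => -[_ /mem_set]; apply/negP.
  - by rewrite memNset// => -[/mem_set + _]; apply/negP.
  - by rewrite memNset// => -[/mem_set + _]; apply/negP.
have mh : measurable_fun setT h.
  apply/(measurable_restrictT _ _).1.
    exact: measurableX.
  by apply/measurable_funTS/measurable_EFinP.
have h0 z : (0 <= h z)%E.
  rewrite /h patchE; case: ifPn => // /set_mem; case: z => x y [/= Ax By].
  by rewrite lee_fin f0.
transitivity (\int[@lebesgue_measure R]_x \int[@lebesgue_measure R]_y h (x, y))%E.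
  rewrite integral_mkcond; apply: eq_integral => x _.
  rewrite patchE; case: ifPn => xA.
    rewrite integral_mkcond; apply: eq_integral => y _.
    by rewrite hE !patchE xA.
  by rewrite integral0_eq// => y _; rewrite hE patchE (negbTE xA).
rewrite fubini_tonelli//.
rewrite [RHS]integral_mkcond; apply: eq_integral => y _.
rewrite patchE; case: ifPn => yB.
  rewrite [RHS]integral_mkcond; apply: eq_integral => x _.
  by rewrite hE !patchE yB.
by rewrite integral0_eq// => x _; rewrite hE !patchE (negbTE yB) if_same.
Qed.

Theorem theorem3p5 (R : realType) :
  (\int[@lebesgue_measure R]_(x in `[0%R, (pi / 2)%R]) (expR (- sec x ^+ 2))%:E)%E
    = (pi / 2 * erfc 1)%:E.
Proof.
rewrite integral_expR_Nsec_sqr.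
under eq_integral => t _.
  rewrite -integral_expR_sqrM ?(lt_le_trans ltr01 (oneDsqr_ge1 t))//.
  over.
rewrite (@ge0_exchange_integral _ _ _
  (fun z => 2 * z.2 * expR (- (z.2 ^+ 2 * oneDsqr z.1))))//=; last 2 first.
- apply: measurable_funM => /=.
    by apply: measurable_funM => //; exact: measurable_snd.
  apply: measurableT_comp => //; apply: measurableT_comp => //.
  apply: measurable_funM.
    by apply: measurable_funX; exact: measurable_snd.
  apply: measurable_funD => //.
  by apply: measurable_funX; exact: measurable_fst.
- move=> t y _ /=; rewrite in_itv/= andbT => y1.
  by rewrite mulr_ge0 ?expR_ge0// mulr_ge0// (le_trans _ y1).
transitivity (\int[@lebesgue_measure R]_(y in `[1%R, +oo[)
    ((Num.sqrt pi)%:E * (gauss_fun y)%:E))%E.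
  apply: eq_integral => y /set_mem /=; rewrite in_itv/= andbT => y1.
  have y0 : 0 < y by rewrite (lt_le_trans _ y1).
  (* Since [y^2 (1 + t^2) = y^2 + (y t)^2], the exponential splits. The factor [y] stays inside as
     the Jacobian of the scaling by [y]. *)
  transitivity (\int[@lebesgue_measure R]_(t in `[0%R, +oo[)
      ((2 * gauss_fun y)%:E * (y * gauss_fun (y * t))%:E))%E.
    apply: eq_integral => t _; rewrite -EFinM; congr EFin.
    rewrite /gauss_fun mulrACA -expRD; congr (_ * expR _).
    by rewrite /oneDsqr; ring.
  rewrite (@ge0_integralZl_EFin _ _ _ (@lebesgue_measure R) `[0, +oo[ _
    (fun t => (y * gauss_fun (y * t))%:E))//; last 3 first.
  - by move=> t _; rewrite lee_fin mulr_ge0 ?gauss_fun_ge0// ltW.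
  - apply/measurable_EFinP/measurable_funTS/measurable_funM => //.
    apply: measurableT_comp; first exact: measurable_gauss_fun.
    exact: measurable_funM.
  - by rewrite mulr_ge0// gauss_fun_ge0.
  rewrite integral0y_gauss_scale// -!EFinM; congr EFin.
  by field.
rewrite (@ge0_integralZl_EFin _ _ _ (@lebesgue_measure R) `[1, +oo[ _
  (fun y => (gauss_fun y)%:E))//; last 2 first.
- by move=> t _; rewrite lee_fin gauss_fun_ge0.
- by apply/measurable_EFinP/measurable_funTS; exact: measurable_gauss_fun.
have ig : (@lebesgue_measure R).-integrable `[1, +oo[ (EFin \o gauss_fun).
  exact: (integrableS measurableT _ _ (@integrableT_gauss R)).
(* [erfc] uses the real-valued integral, so finiteness is needed to leave the extended reals. *)
have /fineK <- : (\int[@lebesgue_measure R]_(y in `[1%R, +oo[)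
    (gauss_fun y)%:E)%E \is a fin_num.
  exact: integrable_fin_num.
rewrite -EFinM; congr EFin.
rewrite /erfc /Rintegral /gauss_fun.
(* With [pi] written as the square of its root, [pi / 2 * (2 / Num.sqrt pi)] reduces to
   [Num.sqrt pi]. *)
rewrite -[X in X / 2](sqr_sqrtr (pi_ge0 R)); field.
by rewrite sqrtr_eq0 -ltNge pi_gt0.
Qed.
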